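(* Let $G$ be the corona $H\circ K_1$ of a connected graph $H$ of order $n\geq 2$. Then $\gamma_{t[1,2]}(G)=\gamma_{[1,2]}(G)$ if and only if $H$ is a path or a cycle.
   Context: All graphs are finite, simple and undirected; $N(v)$ denotes the neighborhood of $v$. The corona $H\circ K_1$ is the graph obtained from $H$ by attaching to each vertex $v\in V(H)$ a new pendant vertex adjacent only to $v$. A set $S\subseteq V(G)$ is a $[1,2]$-set of $G$ if $1\leq |N(v)\cap S|\leq 2$ for every $v\in V(G)\setminus S$; $\gamma_{[1,2]}(G)$ is the minimum cardinality of a $[1,2]$-set. A set $S\subseteq V(G)$ is a total $[1,2]$-set of $G$ if $1\leq |N(v)\cap S|\leq 2$ for every $v\in V(G)$; $\gamma_{t[1,2]}(G)$ is the minimum cardinality of a total $[1,2]$-set, with $\gamma_{t[1,2]}(G)=+\infty$ if none exists. *)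

(* Defs.v *)
From mathcomp Require Import all_boot.

Set Implicit Arguments.
Unset Strict Implicit.
Unset Printing Implicit Defensive.

Record sgraph := SGraph {
  vertex :> finType;
  edge : rel vertex;
  edge_sym : symmetric edge;
  edge_irr : irreflexive edge }.

Definition nbhd (G : sgraph) (v : G) : {set G} := [set u | edge v u].

Definition connected_graph (G : sgraph) : Prop :=
  forall u v : G, connect (@edge G) u v.

Definition isomorphic (G1 G2 : sgraph) : Prop :=
  exists2 f : G1 -> G2, bijective f & forall u v, edge (f u) (f v) = edge u v.

Definition path_edge (n : nat) (i j : 'I_n) : bool :=
  (i.+1 == j) || (j.+1 == i).

Lemma path_edge_sym n : symmetric (@path_edge n).
Proof. by move=> i j; rewrite /path_edge orbC. Qed.

Lemma path_edge_irr n : irreflexive (@path_edge n).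
Proof. by move=> i; rewrite /path_edge orbb gtn_eqF. Qed.

Definition path_graph (n : nat) : sgraph :=
  SGraph (@path_edge_sym n) (@path_edge_irr n).

(* The condition [i != j] only matters for [n = 1]; [path_graph n] and
   [cycle_graph n] are genuine paths and cycles for [0 < n] and [2 < n]
   respectively, as required in [is_path] and [is_cycle]. *)
Definition cycle_edge (n : nat) (i j : 'I_n) : bool :=
  (i != j) && ((i.+1 %% n == j) || (j.+1 %% n == i)).

Lemma cycle_edge_sym n : symmetric (@cycle_edge n).
Proof. by move=> i j; rewrite /cycle_edge eq_sym orbC. Qed.

Lemma cycle_edge_irr n : irreflexive (@cycle_edge n).
Proof. by move=> i; rewrite /cycle_edge eqxx. Qed.

Definition cycle_graph (n : nat) : sgraph :=
  SGraph (@cycle_edge_sym n) (@cycle_edge_irr n).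

Definition is_path (G : sgraph) : Prop :=
  exists2 n, 0 < n & isomorphic G (path_graph n).

Definition is_cycle (G : sgraph) : Prop :=
  exists2 n, 2 < n & isomorphic G (cycle_graph n).

(* In the corona, [inl v] is the vertex [v] of [H] and [inr v] is the pendant
   vertex attached to [v]. *)
Definition corona_edge (H : sgraph) (x y : H + H) : bool :=
  match x, y with
  | inl u, inl v => edge u v
  | inl u, inr v => u == v
  | inr u, inl v => u == v
  | inr _, inr _ => false
  end.

Lemma corona_edge_sym (H : sgraph) : symmetric (@corona_edge H).
Proof. by move=> [u|u] [v|v] //=; rewrite ?(edge_sym u) // eq_sym. Qed.

Lemma corona_edge_irr (H : sgraph) : irreflexive (@corona_edge H).
Proof. by move=> [u|u] //=; rewrite edge_irr. Qed.

Definition corona (H : sgraph) : sgraph :=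
  SGraph (@corona_edge_sym H) (@corona_edge_irr H).

Definition one_two_set (G : sgraph) (S : {set G}) : bool :=
  [forall v, (v \notin S) ==> (1 <= #|nbhd v :&: S| <= 2)].

Definition total_one_two_set (G : sgraph) (S : {set G}) : bool :=
  [forall v, 1 <= #|nbhd v :&: S| <= 2].

Definition gamma12 (G : sgraph) : nat :=
  #|[arg min_(S < [set: G] | one_two_set S) #|S|]|.

(* [None] stands for +oo. *)
Definition gamma_t12 (G : sgraph) : option nat :=
  if [pick S : {set G} | total_one_two_set S] is Some S0
  then Some #|[arg min_(S < S0 | total_one_two_set S) #|S|]| else None.

(* [arg min] is meaningful only if its initial value satisfies the predicate. *)
Lemma one_two_setT (G : sgraph) : one_two_set [set: G].
Proof. by apply/forallP=> v; rewrite in_setT. Qed.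

Lemma gamma12P (G : sgraph) (k : nat) :
  gamma12 G = k <->
  (exists2 S : {set G}, one_two_set S & #|S| = k) /\
  (forall S : {set G}, one_two_set S -> k <= #|S|).
Proof.
rewrite /gamma12; case: arg_minnP => [|S hS minS]; first exact: one_two_setT.
split=> [<-|[[S' hS' <-] min']]; first by split=> //; exists S.
by apply/eqP; rewrite eqn_leq minS //= min'.
Qed.

Lemma gamma_t12P (G : sgraph) (k : nat) :
  gamma_t12 G = Some k <->
  (exists2 S : {set G}, total_one_two_set S & #|S| = k) /\
  (forall S : {set G}, total_one_two_set S -> k <= #|S|).
Proof.
rewrite /gamma_t12; case: pickP => [S0 hS0|noS]; last first.
  by split=> // -[[S]]; rewrite noS.
case: arg_minnP => // S hS minS.
split=> [[<-]|[[S' hS' <-] min']]; first by split=> //; exists S.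
by congr Some; apply/eqP; rewrite eqn_leq minS //= min'.
Qed.

Lemma gamma_t12_oo (G : sgraph) :
  gamma_t12 G = None <-> forall S : {set G}, ~~ total_one_two_set S.
Proof.
rewrite /gamma_t12; case: pickP => [S0 hS0|noS].
  by split=> // /(_ S0); rewrite hS0.
by split=> // _ S; rewrite noS.
Qed.

(* Main.v *)
(** A total [1,2]-set of the corona must contain all of [H], since each pendant
    vertex sees only its support; and every [1,2]-set has at least [#|H|]
    elements, a bound attained by the pendant vertices. So equality holds iff
    [V(H)] itself is a total [1,2]-set, i.e. iff all degrees in [H] are 1 or 2.
    A connected graph of maximum degree at most 2 is spanned by any of its
    longest paths, and the only further edge allowed joins the two ends. *)
Require Import Defs.
From mathcomp Require Import all_boot.

Set Implicit Arguments.
Unset Strict Implicit.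
Unset Printing Implicit Defensive.

Lemma in_nbhd (G : sgraph) (u v : G) : (v \in nbhd u) = edge u v.
Proof. by rewrite inE. Qed.

(** * Domination numbers of the corona *)

Section Corona.

Variable H : sgraph.

Definition core : {set corona H} := [set inl v | v : H].
Definition pendants : {set corona H} := [set inr v | v : H].

Lemma card_core : #|core| = #|H|.
Proof. by rewrite card_imset // => u v []. Qed.

Lemma card_pendants : #|pendants| = #|H|.
Proof. by rewrite card_imset // => u v []. Qed.

Lemma nbhd_pendant (v : H) : @nbhd (corona H) (inr v) = [set inl v].
Proof.
apply/setP=> -[u|u]; rewrite !inE //=.
by apply/eqP/eqP=> [->|[->]].
Qed.

Lemma nbhd_core (v : H) :
  @nbhd (corona H) (inl v) :&: core = [set inl u | u in nbhd v].
Proof.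
apply/setP=> x; rewrite in_setI in_nbhd; apply/andP/imsetP.
- by move=> [exv /imsetP[u _ xu]]; exists u => //; move: exv; rewrite xu in_nbhd.
- by move=> [u]; rewrite in_nbhd => vu ->; split=> //; apply: imset_f.
Qed.

Lemma nbhd_pendants (v : H) :
  @nbhd (corona H) (inl v) :&: pendants = [set inr v].
Proof.
apply/setP=> x; rewrite in_setI in_nbhd in_set1; apply/andP/eqP.
- by move=> [exv /imsetP[u _ xu]]; move: exv; rewrite xu /= => /eqP->.
- by move=> ->; split; [rewrite /= | apply: imset_f].
Qed.

Lemma pendants_one_two : one_two_set pendants.
Proof.
apply/forallP=> -[v|v]; apply/implyP; first by rewrite nbhd_pendants cards1.
by rewrite imset_f.
Qed.

Lemma one_two_set_cover (S : {set corona H}) (v : H) :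
  one_two_set S -> (inl v \in S) || (inr v \in S).
Proof.
move=> /forallP/(_ (inr v)); rewrite nbhd_pendant.
case: (inr v \in S) => /=; first by rewrite orbT.
by case/andP=> /card_gt0P[x]; rewrite in_setI in_set1 => /andP[/eqP->] ->.
Qed.

(** Contracting every pendant edge maps [S] onto [H], because [S] meets each pair formed by a vertex
    and its pendant. *)
Lemma leq_card_one_two_set (S : {set corona H}) :
  one_two_set S -> #|H| <= #|S|.
Proof.
move=> oneS.
pose proj (x : corona H) := match x with inl v => v | inr v => v end.
apply: leq_trans (leq_imset_card proj S); rewrite -cardsT.
apply/subset_leq_card/subsetP=> v _; apply/imsetP.
by have /orP[vS|vS] := one_two_set_cover v oneS; [exists (inl v) | exists (inr v)].
Qed.

Lemma gamma12_corona : gamma12 (corona H) = #|H|.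
Proof.
apply/gamma12P; split; last exact: leq_card_one_two_set.
by exists pendants; [apply: pendants_one_two | apply: card_pendants].
Qed.

Lemma core_sub_total (S : {set corona H}) : total_one_two_set S -> core \subset S.
Proof.
move=> /forallP totS; apply/subsetP=> _ /imsetP[v _ ->].
have /andP[/card_gt0P[x]] := totS (inr v).
by rewrite nbhd_pendant in_setI in_set1 => /andP[/eqP->].
Qed.

(** A pendant vertex has exactly one neighbor in [core], so only the vertices of [H] impose a
    condition, and they see in [core] their neighborhood in [H]. *)
Lemma core_total :
  total_one_two_set core = [forall v : H, 1 <= #|nbhd v| <= 2].
Proof.
have inl_inj : injective (@inl H H) by move=> u v [].
apply/forallP/forallP => [tot v | deg [v|v]].
- by have := tot (inl v); rewrite nbhd_core card_imset.
- by rewrite nbhd_core card_imset.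
- rewrite nbhd_pendant (setIidPl _) ?cards1 //.
  by rewrite sub1set imset_f.
Qed.

Lemma gamma_t12_corona :
  gamma_t12 (corona H) = Some (gamma12 (corona H)) <->
  [forall v : H, 1 <= #|nbhd v| <= 2].
Proof.
rewrite gamma12_corona -core_total; split=> [/gamma_t12P[[S totS cardS] _]|tot].
  (* A total set of size [#|H|] contains [core], which already has that size. *)
  suff -> : core = S by [].
  by apply/eqP; rewrite eqEcard core_sub_total //= cardS card_core.
apply/gamma_t12P; split; first by exists core; rewrite ?card_core.
by move=> S /core_sub_total/subset_leq_card; rewrite card_core.
Qed.

End Corona.

(** * Degree bounds in connected graphs, paths and cycles *)

Lemma connected_deg_gt0 (G : sgraph) (v : G) :
  2 <= #|G| -> connected_graph G -> 0 < #|nbhd v|.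
Proof.
move=> /card_gt1P[a [b [_ _ neq_ab]]] conn.
have [w neq_wv] : exists w, w != v.
  case: (eqVneq a v) => [av|]; last by exists a.
  by exists b; rewrite -av eq_sym.
(* The first edge of a walk from [v] to another vertex provides a neighbor of [v]. *)
have /connectP[[|x p] /=] := conn v w.
  by move=> _ wv; rewrite wv eqxx in neq_wv.
by move=> /andP[vx _] _; apply/card_gt0P; exists x; rewrite in_nbhd.
Qed.

Lemma isomorphic_deg (G1 G2 : sgraph) (k : nat) :
  isomorphic G1 G2 -> (forall v : G2, #|nbhd v| <= k) ->
  forall v : G1, #|nbhd v| <= k.
Proof.
move=> [f /bij_inj f_inj f_edge] deg v.
rewrite -(card_imset _ f_inj); apply: leq_trans (deg (f v)).
apply/subset_leq_card/subsetP=> _ /imsetP[u + ->].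
by rewrite !in_nbhd f_edge.
Qed.

(** Bounds a neighborhood in ['I_n] by a list of natural numbers, whose entries may repeat or fall
    outside the range. *)
Lemma leq_card_injective (T : finType) (U : eqType) (f : T -> U)
    (A : {set T}) (s : seq U) :
  injective f -> (forall x, x \in A -> f x \in s) -> #|A| <= size s.
Proof.
move=> f_inj As; rewrite cardE -(size_map f); apply: uniq_leq_size.
  by rewrite map_inj_uniq ?enum_uniq.
by move=> _ /mapP[x + ->]; rewrite mem_enum; apply: As.
Qed.

Lemma path_graph_deg (n : nat) (i : path_graph n) : #|nbhd i| <= 2.
Proof.
apply: (@leq_card_injective (path_graph n) _ val _ [:: i.+1; i.-1] val_inj) => j.
rewrite in_nbhd /= /path_edge !inE => /orP[/eqP<-|/eqP<-]; first by rewrite eqxx.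
by rewrite eqxx orbT.
Qed.

Lemma cycle_graph_deg (n : nat) (i : cycle_graph n) : #|nbhd i| <= 2.
Proof.
(* Adding [n.-1] is subtracting one modulo [n], which also gives the right predecessor of 0. *)
pose s := [:: i.+1 %% n; (i + n.-1) %% n].
apply: (@leq_card_injective (cycle_graph n) _ val _ s val_inj) => j.
rewrite in_nbhd /= /cycle_edge !inE => /andP[_ /orP[/eqP<-|/eqP<-]].
  by rewrite eqxx.
rewrite modnDml addSnnS prednK ?(leq_trans _ (ltn_ord j)) //.
by rewrite modnDr (modn_small (ltn_ord j)) eqxx orbT.
Qed.

(** * Connected graphs of maximum degree at most two *)

Section MaxDegreeTwo.

Variable G : sgraph.
Hypothesis G_conn : connected_graph G.
Hypothesis G_deg : forall v : G, #|nbhd v| <= 2.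

Lemma three_neighbors (v a b c : G) :
  edge v a -> edge v b -> edge v c -> ~~ uniq [:: a; b; c].
Proof.
move=> va vb vc; apply/negP=> abc; suff: 3 <= #|nbhd v| by rewrite ltnNge G_deg.
rewrite cardE -[3]/(size [:: a; b; c]); apply: uniq_leq_size => // x.
by rewrite mem_enum in_nbhd !inE => /or3P[] /eqP->.
Qed.

Lemma longest_path (x0 : G) :
  exists2 p : seq G, uniq p && sorted (@edge G) p &
    0 < size p /\
    forall q : seq G, uniq q -> sorted (@edge G) q -> size q <= size p.
Proof.
(* Fixing the length makes the existence of a path decidable, so a maximal length can be
   extracted. *)
pose P k := [exists t : k.-tuple G, uniq t && sorted (@edge G) t].
have P1 : P 1 by apply/existsP; exists [tuple x0].
have Pmax k : P k -> k <= #|G|.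
  move=> /existsP[t /andP[t_uniq _]].
  by rewrite -(size_tuple t) -(card_uniqP t_uniq) max_card.
case: (ex_maxnP (ex_intro P 1 P1) Pmax) => m /existsP[t tP] max_m.
exists t => //; rewrite size_tuple; split=> [|q q_uniq q_sorted]; first exact: max_m.
by apply: max_m; apply/existsP; exists (in_tuple q); rewrite q_uniq.
Qed.

Lemma path_nth_edge (x0 : G) (p : seq G) (i : nat) :
  sorted (@edge G) p -> i.+1 < size p -> edge (nth x0 p i) (nth x0 p i.+1).
Proof. by move=> /(sortedP x0); apply. Qed.

(** The vertices of [p] are closed under adjacency: an outside neighbor of an end would lengthen
    [p], and one of an interior vertex would be its third neighbor. Connectedness then gives every
    vertex. *)
Lemma longest_path_spans (x0 : G) (p : seq G) :
  uniq p -> sorted (@edge G) p -> 0 < size p ->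
  (forall q : seq G, uniq q -> sorted (@edge G) q -> size q <= size p) ->
  forall v, v \in p.
Proof.
move=> p_uniq p_sorted p_gt0 p_max.
have p_closed u w : edge u w -> u \in p -> w \in p.
  move=> uw u_p; apply/negPn/negP=> w_p; pose i := index u p.
  have i_lt : i < size p by rewrite index_mem.
  have p_i : nth x0 p i = u by rewrite nth_index.
  case: (posnP i) => [i0|i_gt0].
    suff: size (w :: p) <= size p by rewrite /= ltnn.
    apply: p_max; first by rewrite /= w_p.
    move: p_i p_sorted; rewrite i0; case: (p) => //= a s -> ->.
    by rewrite edge_sym uw.
  case: (ltnP i.+1 (size p)) => [i_lt'|i_ge]; last first.
    suff: size (rcons p w) <= size p by rewrite size_rcons ltnn.
    apply: p_max; first by rewrite rcons_uniq w_p.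
    have p_size : size p = i.+1 by apply/eqP; rewrite eqn_leq i_ge i_lt.
    have : last x0 p = u by rewrite -nth_last p_size.
    move: p_gt0 p_sorted; case: (p) => //= a s _ a_s last_s.
    by rewrite rcons_path a_s last_s.
  have e1 : edge u (nth x0 p i.+1) by rewrite -p_i path_nth_edge.
  have e2 : edge u (nth x0 p i.-1).
    by rewrite edge_sym -p_i -{2}(prednK i_gt0) path_nth_edge ?prednK.
  have := three_neighbors e1 e2 uw.
  have lt1 : i.-1 < size p by rewrite (leq_ltn_trans (leq_pred _)).
  rewrite /= !inE !andbT nth_uniq // !negb_or.
  rewrite [i.+1 == _]gtn_eqF ?ltnS ?leq_pred //=.
  by rewrite !(contraNneq _ w_p) // => <-; rewrite mem_nth.
(* Closure is propagated along a walk from the head of [p], by induction with its starting vertex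
   generalized. *)
move=> v; have /connectP[s] := G_conn (nth x0 p 0) v.
have := mem_nth x0 p_gt0.
elim: s (nth x0 p 0) => [|y s IHs] u u_p /=; first by move=> _ ->.
by move=> /andP[uy ys]; apply: IHs ys; apply: p_closed uy u_p.
Qed.

(* A chord at an interior vertex would give it a third neighbor. *)
Lemma spanning_path_edge (x0 : G) (p : seq G) (i j : nat) :
  uniq p -> sorted (@edge G) p -> i < j < size p ->
  edge (nth x0 p i) (nth x0 p j) ->
  i.+1 = j \/ i = 0 /\ j.+1 = size p.
Proof.
move=> p_uniq p_sorted /andP[ij jp] e_ij.
case: (eqVneq i.+1 j) => [|neq_ij]; [by left | right].
have ij' : i.+1 < j by rewrite ltn_neqAle neq_ij.
have ip : i.+1 < size p := ltn_trans ij' jp.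
have e_next := path_nth_edge x0 p_sorted ip.
have j_gt0 : 0 < j := leq_ltn_trans (leq0n i) ij.
have e_prev : edge (nth x0 p j) (nth x0 p j.-1).
  by rewrite edge_sym -{2}(prednK j_gt0) path_nth_edge ?prednK.
have ij1 : i < j.-1 by rewrite -ltnS prednK.
have j1p : j.-1 < size p by rewrite prednK // ltnW.
split.
(* Otherwise position [i] is adjacent to the distinct positions [i.-1], [i.+1] and [j]. *)
- apply/eqP; rewrite -leqn0 leqNgt; apply/negP=> i_gt0.
  have e_before : edge (nth x0 p i) (nth x0 p i.-1).
    by rewrite edge_sym -{2}(prednK i_gt0) path_nth_edge ?prednK // ltnW.
  have i1i : i.-1 < i by rewrite prednK.
  have := three_neighbors e_before e_next e_ij.
  rewrite /= !inE !andbT !nth_uniq ?(ltn_trans i1i) ?(ltnW ip) //.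
  by rewrite !ltn_eqF // ?(ltn_trans i1i) // ltnS ltnW.
(* Symmetrically, position [j] would be adjacent to [i], [j.-1] and [j.+1]. *)
- apply/eqP; rewrite eqn_leq jp leqNgt; apply/negP=> j_lt.
  have e_after := path_nth_edge x0 p_sorted j_lt.
  rewrite edge_sym in e_ij.
  have := three_neighbors e_ij e_prev e_after.
  rewrite /= !inE !andbT !nth_uniq // ?(ltn_trans ij) //.
  by rewrite !ltn_eqF // ?prednK // ltnW // ltnS.
Qed.

(** The isomorphism sends a vertex to its position on a longest path; whether the two ends are
    adjacent selects the model. *)
Lemma path_or_cycle : 0 < #|G| -> is_path G \/ is_cycle G.
Proof.
move=> /card_gt0P[x0 _].
have [p /andP[p_uniq p_sorted] [p_gt0 p_max]] := longest_path x0.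
have p_all := longest_path_spans x0 p_uniq p_sorted p_gt0 p_max.
have idx_lt v : index v p < size p by rewrite index_mem.
pose f v : 'I_(size p) := Ordinal (idx_lt v).
have f_bij : bijective f.
  exists (fun i : 'I_(size p) => nth x0 p i) => [v|i]; first by rewrite /= nth_index.
  by apply: val_inj; rewrite /= index_uniq.
have nthf v : nth x0 p (f v) = v by rewrite /= nth_index.
have consec u v : (f u).+1 = f v -> edge u v.
  by move=> uv; rewrite -(nthf u) -(nthf v) -uv path_nth_edge // uv ltn_ord.
pose a := nth x0 p 0; pose b := nth x0 p (size p).-1.
have fa u : f u = 0 :> nat -> u = a by rewrite -{2}(nthf u) => ->.
have fb u : (f u).+1 = size p -> u = b.
  by move=> u_last; rewrite -(nthf u) /b; congr nth; rewrite -[in RHS]u_last.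
have wlog_edge (e : rel G) :
    symmetric e -> (forall u, ~~ e u u) ->
    (forall u v, f u < f v -> e u v = edge u v) -> forall u v, e u v = edge u v.
  move=> e_sym e_irr e_lt u v; case: (ltngtP (f u) (f v)) => [|vu|].
  - exact: e_lt.
  - by rewrite e_sym edge_sym e_lt.
  - move=> /val_inj/(bij_inj f_bij)->; rewrite edge_irr; exact/negbTE.
(* On two vertices the edge between the ends is the path itself, so a closing edge counts only from
   three vertices on. *)
case: (boolP ((2 < size p) && edge a b)) => [/andP[p_gt2 ab]|chordless].
- right; exists (size p) => //; exists f => //.
  apply: wlog_edge => [u v|u|u v uv]; first exact: (@edge_sym (cycle_graph _)).
    by rewrite (@edge_irr (cycle_graph _)).
  rewrite /= /cycle_edge -(inj_eq val_inj) (ltn_eqF uv) /=.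
  have uv' : (f u).+1 < size p by rewrite (leq_ltn_trans uv).
  rewrite (modn_small uv'); apply/orP/idP => [[/eqP|/eqP]|uv_edge].
  + exact: consec.
  (* As [f u < f v], the successor of [f v] can equal [f u] only by wrapping around, so [u] and [v]
     are the two ends. *)
  + have [v_lt|v_ge] := ltnP (f v).+1 (size p).
      by rewrite modn_small // => vu; move: uv; rewrite /= -vu ltnNge leqnSn.
    have vE : (f v).+1 = size p by apply/eqP; rewrite eqn_leq v_ge ltn_ord.
    by rewrite vE modnn => /esym/fa->; rewrite (fb v).
  + have := @spanning_path_edge x0 p (f u) (f v) p_uniq p_sorted.
    rewrite uv ltn_ord !nthf => /(_ isT uv_edge) [->|[u0 vE]]; first by left.
    by right; rewrite vE modnn eq_sym; apply/eqP.
- left; exists (size p) => //; exists f => //.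
  apply: wlog_edge => [u v|u|u v uv]; first exact: (@edge_sym (path_graph _)).
    by rewrite (@edge_irr (path_graph _)).
  rewrite /= /path_edge.
  rewrite [X in _ || X](_ : _ = false) ?orbF; last first.
    by rewrite gtn_eqF // ltnS ltnW.
  apply/eqP/idP => [|uv_edge]; first exact: consec.
  have := @spanning_path_edge x0 p (f u) (f v) p_uniq p_sorted.
  rewrite uv ltn_ord !nthf => /(_ isT uv_edge) [//|[u0 vE]].
  (* Adjacent ends now force at most two vertices, so positions 0 and [f v] are consecutive after
     all. *)
  move: chordless; rewrite -(fa u u0) -(fb v vE) uv_edge andbT -leqNgt => p_le2.
  have v_le1 : f v <= 1 by rewrite -ltnS vE.
  by apply/eqP; rewrite eqn_leq uv (leq_trans v_le1).
Qed.

End MaxDegreeTwo.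

Theorem theorem4p1 (H : sgraph) (n : nat) :
  #|H| = n -> 2 <= n -> connected_graph H ->
  (gamma_t12 (corona H) = Some (gamma12 (corona H)) <->
   is_path H \/ is_cycle H).
Proof.
move=> <- H_gt1 H_conn; split=> [/gamma_t12_corona/forallP deg|pc].
  apply: path_or_cycle => // [v|]; last exact: ltnW.
  by case/andP: (deg v).
apply/gamma_t12_corona/forallP=> v; rewrite connected_deg_gt0 //=.
case: pc => -[m _ iso]; apply: isomorphic_deg iso _ v => w.
- exact: path_graph_deg.
- exact: cycle_graph_deg.
Qed.
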